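(* Let $r\ge 0$ and $n$ be integers with $n>r+1$, and let $C_{2n+1}$ denote the cycle on $2n+1$ vertices. Then $\omega(\mathcal M^{2r}(C_{2n+1}))=2$, $\alpha^\circ(\mathcal M^{2r}(C_{2n+1}))=2r+2$, and $\chi(\mathcal M^{2r}(C_{2n+1}))=2r+3$.
   Context: All graphs are finite, undirected and simple; $\chi$ denotes the chromatic number and $\omega$ the clique number. The length of a cycle is its number of vertices. Circular altitude. A circular ordering $\sigma$ of $V(G)$ is a one-to-one assignment of $V(G)$ to the vertices of a directed cycle. A cycle $u_1,u_2,\ldots,u_n$ of $G$ is monotonic for $\sigma$ if $u_1,\ldots,u_n,u_1$ appear in this circular order in $\sigma$. Edges of $G$ are regarded as monotonic cycles of length two. The circular altitude $\alpha^\circ(G)$ of a graph $G$ with at least one edge is the largest $k$ such that every circular ordering of $V(G)$ contains a monotonic cycle of length at least $k$. Mycielskian. Given a graph $G$, the Mycielskian $\mathcal M(G)$ has vertex set $\{w\}\cup\{a^u \mid a\in V(G)\}\cup\{a^v\mid a\in V(G)\}$ (all these vertices distinct; $u,v$ are formal labels). Its edges are: $a^v b^v$, $a^u b^v$ and $b^u a^v$ for every edge $ab$ of $G$, and $w a^u$ for every $a\in V(G)$; there are no other edges. $\mathcal M^0(G)=G$ and $\mathcal M^{d}(G)=\mathcal M(\mathcal M^{d-1}(G))$ for $d\ge 1$. *)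

(* Defs.v *)
From mathcomp Require Import all_boot.
Set Implicit Arguments.
Unset Strict Implicit.
Unset Printing Implicit Defensive.

Record sgraph := SGraph {
  vertex :> finType;
  edge : rel vertex;
  edge_sym : symmetric edge;
  edge_irrefl : irreflexive edge
}.

Definition clique (G : sgraph) (A : {set G}) : bool :=
  [forall x in A, forall y in A, (x != y) ==> edge x y].

Definition clique_number (G : sgraph) : nat :=
  \max_(A : {set G} | clique A) #|A|.

Definition proper_coloring (G : sgraph) (k : nat) (f : {ffun G -> 'I_k}) : bool :=
  [forall x, forall y, edge x y ==> (f x != f y)].

Definition colorable (G : sgraph) (k : nat) : bool :=
  [exists f : {ffun G -> 'I_k}, proper_coloring f].

Lemma colorable_exists (G : sgraph) : exists k, colorable G k.
Proof.
exists #|G|; apply/existsP; exists [ffun x => enum_rank x].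
apply/forallP=> x; apply/forallP=> y; apply/implyP=> xy; rewrite !ffunE.
by apply: contraTneq xy => /enum_rank_inj ->; rewrite edge_irrefl.
Qed.

Definition chromatic_number (G : sgraph) : nat := ex_minn (colorable_exists G).

(* 'I_#|G| stands for the vertex set of the directed cycle 0 -> 1 -> ... -> 0. *)
Definition circular_ordering (G : sgraph) (sigma : {ffun G -> 'I_#|G|}) : bool :=
  injectiveb sigma.

(* Going once around the directed cycle from 0, the vertices listed in c are   *)
(* met in increasing position; so they appear in the circular order c exactly  *)
(* when the positions increase along some rotation of c.                       *)
Definition in_circular_order (G : sgraph) (sigma : {ffun G -> 'I_#|G|})
    (c : seq G) : bool :=
  [exists i : 'I_(size c), sorted ltn [seq val (sigma x) | x <- rot i c]].

(* Size two is the case of an edge xy, listed as [:: x; y]; it is in circular  *)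
(* order for every circular ordering.                                          *)
Definition monotonic_cycle (G : sgraph) (sigma : {ffun G -> 'I_#|G|})
    (c : seq G) : bool :=
  [&& 2 <= size c, ucycleb (@edge G) c & in_circular_order sigma c].

(* A cycle has no repeated vertex, so sequences of size at most #|G| suffice.  *)
Definition altitude_ge (G : sgraph) (k : nat) : bool :=
  [forall (sigma : {ffun G -> 'I_#|G|} | circular_ordering sigma),
     exists c : {bseq #|G| of G}, monotonic_cycle sigma c && (k <= size c)].

(* The value is 0 when G has no edge. *)
Definition circular_altitude (G : sgraph) : nat :=
  \max_(k < #|G|.+1 | altitude_ge G k) k.

Lemma altitude_geP (G : sgraph) (k : nat) :
  reflect (forall sigma : {ffun G -> 'I_#|G|}, injective sigma ->
             exists2 c : seq G, monotonic_cycle sigma c & k <= size c)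
          (altitude_ge G k).
Proof.
apply: (iffP forall_inP) => H sigma sinj.
  have [|c /andP[mc kc]] := existsP (H sigma _); first exact/injectiveP.
  by exists c.
have [c mc kc] := H sigma (injectiveP _ sinj).
have sc : size c <= #|G|.
  by case/and3P: mc => _ /andP[_ /card_uniqP <-] _; apply: max_card.
by apply/existsP; exists (Bseq sc); rewrite mc.
Qed.

Lemma circular_altitude_largest (G : sgraph) : (exists x y : G, edge x y) ->
  altitude_ge G (circular_altitude G) /\
  (forall k, altitude_ge G k -> k <= circular_altitude G).
Proof.
move=> [x [y xy]].
have nxy : x != y by apply: contraTneq xy => ->; rewrite edge_irrefl.
have ge0 : altitude_ge G 0.
  apply/altitude_geP=> sigma sinj; exists [:: x; y] => //; apply/and3P; split=> //.
    by rewrite /ucycleb /= xy edge_sym xy mem_seq1 nxy.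
  apply/existsP; have : val (sigma x) != val (sigma y).
    by apply: contra_neq nxy => /val_inj/sinj.
  rewrite neq_ltn => /orP[lt|lt].
    by exists ord0; rewrite rot0 /= lt.
  by exists (lift ord0 ord0); rewrite /= lt.
split.
  rewrite /circular_altitude.
  have [|k gek ->] := @eq_bigmax_cond _ [pred k : 'I_#|G|.+1 | altitude_ge G k] val.
    by apply/card_gt0P; exists ord0.
  exact: gek.
move=> k gek.
have kG : k < #|G|.+1.
  have sinj : injective [ffun z : G => enum_rank z].
    by move=> a b; rewrite !ffunE => /enum_rank_inj.
  have [c mc kc] := altitude_geP _ _ gek _ sinj.
  rewrite ltnS; apply: leq_trans kc _.
  by case/and3P: mc => _ /andP[_ /card_uniqP <-] _; apply: max_card.
exact: (@leq_bigmax_cond _ [pred k : 'I_#|G|.+1 | altitude_ge G k] val (Ordinal kG)).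
Qed.

(* w is None, a^u is Some (inl a) and a^v is Some (inr a). *)
Definition mycielskian_edge (G : sgraph) : rel (option (G + G)) :=
  fun p q => match p, q with
  | Some (inr a), Some (inr b) => edge a b
  | Some (inl a), Some (inr b) => edge a b
  | Some (inr a), Some (inl b) => edge a b
  | None, Some (inl _) => true
  | Some (inl _), None => true
  | _, _ => false
  end.

Lemma mycielskian_edge_sym (G : sgraph) : symmetric (@mycielskian_edge G).
Proof. by move=> [[a|a]|] [[b|b]|] //=; exact: edge_sym. Qed.

Lemma mycielskian_edge_irrefl (G : sgraph) : irreflexive (@mycielskian_edge G).
Proof. by move=> [[a|a]|] //=; exact: edge_irrefl. Qed.

Definition mycielskian (G : sgraph) : sgraph :=
  SGraph (@mycielskian_edge_sym G) (@mycielskian_edge_irrefl G).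

(* The conjunct i != j only matters for m = 1, where it removes the loop. *)
Definition cycle_graph_edge (m : nat) : rel 'I_m :=
  fun i j => (i != j) && ((j == i.+1 %% m :> nat) || (i == j.+1 %% m :> nat)).

Lemma cycle_graph_edge_sym (m : nat) : symmetric (@cycle_graph_edge m).
Proof. by move=> i j; rewrite /cycle_graph_edge eq_sym orbC. Qed.

Lemma cycle_graph_edge_irrefl (m : nat) : irreflexive (@cycle_graph_edge m).
Proof. by move=> i; rewrite /cycle_graph_edge eqxx. Qed.

Definition cycle_graph (m : nat) : sgraph :=
  SGraph (@cycle_graph_edge_sym m) (@cycle_graph_edge_irrefl m).

(* Main.v *)
(* Clique and chromatic numbers follow from Mycielski's classical arguments.   *)
(*                                                                             *)
(* Altitude, upper bound: let K = 4r + 5 and colour the vertices with residues *)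
(* mod K so that adjacent vertices are at circular distance at least 2. Such a *)
(* colouring exists for r = 0, and two Mycielskian steps cost only 4 new       *)
(* colours. If the vertices are listed by increasing colour, a monotonic cycle *)
(* of length l gives 2l <= K, hence l <= 2r + 2.                               *)
(*                                                                             *)
(* Altitude, lower bound: a mod 2 version of Ky Fan's theorem, in the complex  *)
(* of signed bicliques (A, B), where A and B are completely joined and the     *)
(* antipode exchanges A and B. An edge yields an antipodally symmetric         *)
(* 1-sphere, and the Mycielskian suspends spheres: the v-copy of a sphere      *)
(* bounds the prism between the copies (v, v) and (u, v), followed by the cone *)
(* over the latter with apex w, of sign -, as w is joined to all a^u. Fan's    *)
(* counting argument then finds, for every linear order of the vertices, a     *)
(* biclique on 2r + 2 vertices whose signs alternate: a monotonic cycle.       *)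
Require Import Defs.
From mathcomp Require Import all_boot.
From mathcomp Require Import zify.

Set Implicit Arguments.
Unset Strict Implicit.
Unset Printing Implicit Defensive.

(** By [mycielskian_colorable] each Mycielskian costs exactly one colour, starting from 3 for the
    odd cycle, and by [mycielskian_triangle_free] it creates no triangle. The altitude is squeezed
    between two counts. A circular colouring with 4r + 5 residues gives an ordering whose monotonic
    cycles have length l with 2l <= 4r + 5 ([circular_altitude_circ_colorable]). Conversely, an edge
    carries a hemisphere of dimension 1 ([hemisphere_edge]), each Mycielskian raises the dimension
    by one ([mycielskian_hemisphere]), and in dimension 2r + 1 Fan's argument finds an alternating
    simplex on 2r + 2 vertices, which closes up to a cycle because 2r + 2 is even
    ([hemisphere_altitude_ge]). *)

(** * Chromatic number *)

Lemma mycielskian_colorable (G : sgraph) (k : nat) :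
  colorable (mycielskian G) k.+1 = colorable G k.
Proof.
apply/existsP/existsP => -[f /forallP fP].
  set c := f (None : mycielskian G).
  have neq (x y : mycielskian G) : edge x y -> f x != f y.
    by move=> xy; have /forallP/(_ y)/implyP/(_ xy) := fP x.
  (* A vertex whose v-copy has the apex colour [c] borrows the colour of its u-copy, which is
     adjacent to the apex. Two adjacent vertices never both borrow, so the result is proper and
     omits [c]. *)
  pose g (x : G) := if f (Some (inr x) : mycielskian G) == c
                    then f (Some (inl x) : mycielskian G)
                    else f (Some (inr x) : mycielskian G).
  have gc x : c != g x.
    rewrite /g; case: ifP => [_|/negbT]; last by rewrite eq_sym.
    exact: (@neq None (Some (inl x))).
  pose h x := sval (unlift_some (gc x)).
  have hP x : g x = lift c (h x) by rewrite /h; case: (unlift_some _).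
  exists [ffun x => h x]; apply/forallP=> x; apply/forallP=> y.
  apply/implyP=> xy; rewrite !ffunE; apply: contraTneq isT => hxy.
  have : g x = g y by rewrite !hP hxy.
  rewrite /g.
  have := @neq (Some (inr x)) (Some (inr y)) xy.
  have := @neq (Some (inr x)) (Some (inl y)) xy.
  have := @neq (Some (inl x)) (Some (inr y)) xy.
  by case: ifP => [/eqP->|_]; case: ifP => [/eqP->|_] h1 h2 h3 e;
    move: h1 h2 h3; rewrite e eqxx.
pose F (x : mycielskian G) : 'I_k.+1 :=
  match x with
  | None => ord_max
  | Some (inl a) | Some (inr a) => lift ord_max (f a) end.
exists [ffun x => F x]; apply/forallP=> x; apply/forallP=> y.
have neq (a b : G) : edge a b -> f a != f b.
  by move=> xy; have /forallP/(_ b)/implyP/(_ xy) := fP a.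
apply/implyP; rewrite !ffunE.
case: x y => [[a|a]|] [[b|b]|] //=; rewrite ?(inj_eq lift_inj) ?neq_lift //.
- exact: neq.
- by rewrite eq_sym neq_lift.
- exact: neq.
- exact: neq.
Qed.

Lemma iter_mycielskian_colorable (G : sgraph) (d k : nat) :
  colorable (iter d mycielskian G) (d + k) = colorable G k.
Proof. by elim: d => //= d IHd; rewrite addSn mycielskian_colorable. Qed.

Lemma colorable_leq (G : sgraph) (j k : nat) :
  j <= k -> colorable G j -> colorable G k.
Proof.
move=> jk /existsP[f /forallP fP]; apply/existsP.
exists [ffun x => widen_ord jk (f x)]; apply/forallP=> x; apply/forallP=> y.
by rewrite !ffunE; have /forallP/(_ y) := fP x.
Qed.

Lemma chromatic_number_iter_mycielskian (G : sgraph) (d k : nat) :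
  colorable G k.+1 -> ~~ colorable G k ->
  chromatic_number (iter d mycielskian G) = d + k.+1.
Proof.
move=> colk ncolk; rewrite /chromatic_number; case: ex_minnP => m colm minm.
apply/eqP; rewrite eqn_leq minm ?iter_mycielskian_colorable //=.
rewrite addnS ltnNge; apply: contra ncolk => mk.
by rewrite -(iter_mycielskian_colorable G d); apply: colorable_leq colm.
Qed.

Lemma cycle_graph_edge_cases (m : nat) (i j : cycle_graph m) : edge i j ->
  j = i.+1 :> nat \/ i = j.+1 :> nat \/
  (i.+1 = m /\ j = 0 :> nat) \/ (j.+1 = m /\ i = 0 :> nat).
Proof.
have modS (k : 'I_m) : k.+1 %% m = if k.+1 == m then 0 else k.+1.
  case: eqP => [->|/eqP km]; first by rewrite modnn.
  by rewrite modn_small // ltn_neqAle km ltn_ord.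
case/andP=> _; rewrite !modS => /orP[] /eqP ->; case: eqP => km.
- by right; right; left.
- by left.
- by right; right; right.
- by right; left.
Qed.

Lemma cycle_graph_edgeS (m i : nat) (lti : i < m) (ltSi : i.+1 < m) :
  @edge (cycle_graph m) (Ordinal lti) (Ordinal ltSi).
Proof.
by rewrite /= /cycle_graph_edge -val_eqE /= neq_ltn ltnS leqnn modn_small ?eqxx.
Qed.

Lemma colorable_odd_cycle_graph (n : nat) :
  colorable (cycle_graph (2 * n + 1)) 3.
Proof.
have lt3 i : (if i == 2 * n then 2 else odd i : nat) < 3 by case: ifP => //; case: odd.
apply/existsP; exists [ffun i : cycle_graph _ => Ordinal (lt3 (i : 'I__))].
apply/forallP=> i; apply/forallP=> j; apply/implyP=> ij; rewrite !ffunE -val_eqE /=.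
have := cycle_graph_edge_cases ij; have nij : i != j :> nat by case/andP: ij.
by have := ltn_ord i; have := ltn_ord j; move: nij; repeat case: ifP; lia.
Qed.

Lemma odd_cycle_graph_not_bipartite (n : nat) : 0 < n ->
  ~~ colorable (cycle_graph (2 * n + 1)) 2.
Proof.
move=> n0; apply/negP=> /existsP[f /forallP fP].
pose m := 2 * n + 1.
have neq (x y : cycle_graph m) : edge x y -> val (f x) != val (f y).
  by move=> xy; have /forallP/(_ y)/implyP/(_ xy) := fP x.
have m0 : 0 < m by rewrite /m addn1.
(* Two colours are forced to alternate from vertex 0 on; the edge joining 0 to the even vertex 2n is
   then violated. *)
have par i (lti : i < m) :
    val (f (Ordinal lti)) = odd (i + val (f (Ordinal m0))) :> nat.
  elim: i lti => [|i IHi] lti.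
    have -> : Ordinal lti = Ordinal m0 by apply: val_inj.
    by case: (f _) => -[|[|]].
  have lti' : i < m by apply: ltnW.
  have := neq _ _ (cycle_graph_edgeS lti' lti).
  rewrite IHi addSn /=; case: (f (Ordinal lti)) => -[|[|]] //= _; by case: odd.
have ltn2 : 2 * n < m by rewrite /m addn1.
have := @neq (Ordinal ltn2) (Ordinal m0); rewrite par.
have -> : @edge (cycle_graph m) (Ordinal ltn2) (Ordinal m0).
  rewrite /= /cycle_graph_edge -val_eqE /= /m addn1 modnn eqxx /=; lia.
move/(_ isT); rewrite oddD oddM /=.
by case: (f _) => -[|[|]].
Qed.

(** * Clique number *)

Definition triangle_free (G : sgraph) : Prop :=
  forall x y z : G, edge x y -> edge y z -> edge x z -> False.

(** The u-copies are independent and contain all neighbours of the apex, so a triangle avoids the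
    apex and projects to a triangle of [G]. *)
Lemma mycielskian_triangle_free (G : sgraph) :
  triangle_free G -> triangle_free (mycielskian G).
Proof.
by move=> tf [[x|x]|] [[y|y]|] [[z|z]|] //=; apply: tf.
Qed.

Lemma cycle_graph_triangle_free (m : nat) : 3 < m -> triangle_free (cycle_graph m).
Proof.
move=> m3 x y z xy yz xz.
have := cycle_graph_edge_cases xy; have := cycle_graph_edge_cases yz.
have := cycle_graph_edge_cases xz.
by have := ltn_ord x; have := ltn_ord y; have := ltn_ord z; lia.
Qed.

Lemma triangle_free_clique_number (G : sgraph) (x y : G) :
  triangle_free G -> edge x y -> clique_number G = 2.
Proof.
move=> tf xy; apply/eqP; rewrite eqn_leq; apply/andP; split.
  apply/bigmax_leqP=> A /forall_inP cA; rewrite leqNgt.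
  apply/negP=> /card_gt2P[a [b [c [[aA bA cA'] [ab bc ca]]]]].
  have adj u v : u \in A -> v \in A -> u != v -> edge u v.
    by move=> uA vA; have /forall_inP/(_ v vA)/implyP := cA u uA.
  by apply: (tf a b c); apply: adj; rewrite // eq_sym.
have nxy : x != y by apply: contraTneq xy => ->; rewrite edge_irrefl.
rewrite -[2](_ : #|[set x; y]| = 2); last by rewrite cards2 nxy.
apply: (@leq_bigmax_cond _ _ (fun A : {set G} => #|A|)).
apply/forall_inP=> a /set2P[] ->; apply/forall_inP=> b /set2P[] ->;
  by rewrite ?eqxx ?xy 1?edge_sym ?xy ?implybT.
Qed.

(** * Upper bound on the altitude: circular colourings *)

(** For residues below [K] this is circular distance at least 2, so [circ_colorable K] asks for a
    (K,2)-colouring. *)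
Definition circ_far (K a b : nat) : bool :=
  (a + 2 <= b) && (b + 2 <= a + K) || (b + 2 <= a) && (a + 2 <= b + K).

Definition circ_colorable (K : nat) (G : sgraph) : Prop :=
  exists2 f : G -> nat, (forall x, f x < K) &
    (forall x y, edge x y -> circ_far K (f x) (f y)).

Lemma circ_colorable_odd_cycle (n : nat) : 1 < n ->
  circ_colorable 5 (cycle_graph (2 * n + 1)).
Proof.
(* The colours run 0, 2, 4, 1, 3, 1, 3, ...; as the length is at least 5, the last one is 3, at
   distance 2 from 0. *)
move=> n1; exists (fun i : 'I_(2 * n + 1) =>
    if i <= 2 then 2 * i else if odd i then 1 else 3).
  by move=> i; case: ifP => [/(leq_mul (leqnn 2))|_]; [lia | case: odd].
move=> i j ij; have := cycle_graph_edge_cases ij.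
by have := ltn_ord i; have := ltn_ord j; rewrite /circ_far; repeat case: ifP; lia.
Qed.

(* The residues keep their values and the new ones K, .., K + 3 are inserted   *)
(* between K - 1 and 0.                                                        *)
Lemma circ_colorable_mycielskian2 (K : nat) (G : sgraph) : 4 < K ->
  circ_colorable K G ->
  circ_colorable (K + 4) (mycielskian (mycielskian G)).
Proof.
move=> K4 [f fK fE].
(* The outer apex keeps its neighbours off K + 2, K + 3 and 0; both copies of the inner apex share K
   - 1 and keep theirs off K - 2, K - 1 and K. The case distinctions move the offending residues. *)
exists (fun x : mycielskian (mycielskian G) => match x with
  | None => K + 3
  | Some (inl None) | Some (inr None) => K - 1
  | Some (inr (Some (inr x))) => f x
  | Some (inr (Some (inl x))) =>
      if f x <= 1 then 0 else
      if f x + 1 == K then K + 1 else if f x + 2 == K then K + 2 else f x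
  | Some (inl (Some (inr x))) => if f x == 0 then K else f x
  | Some (inl (Some (inl x))) =>
      if (f x == 0) || (K <= f x + 2) then K + 1 else f x
  end).
  by move=> [[[[x|x]|]|[[x|x]|]]|]; try (have := fK x); repeat case: ifP; lia.
move=> [[[[x|x]|]|[[x|x]|]]|] [[[[y|y]|]|[[y|y]|]]|] //=;
  try move/fE; try (have := fK x); try (have := fK y); rewrite /circ_far;
  repeat case: ifP; lia.
Qed.

Lemma circ_colorable_iter_mycielskian (K r : nat) (G : sgraph) : 4 < K ->
  circ_colorable K G ->
  circ_colorable (K + 4 * r) (iter (2 * r) mycielskian G).
Proof.
move=> K4 cG; elim: r => [|r IHr]; first by rewrite muln0 addn0.
rewrite !mulnS add2n /= addnCA addnC.
by apply: circ_colorable_mycielskian2 IHr; rewrite ltn_addr.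
Qed.

Lemma circular_altitude_circ_colorable (K m : nat) (G : sgraph) :
  K <= 2 * m + 1 -> 0 < m -> circ_colorable K G -> circular_altitude G <= m.
Proof.
move=> Km m0 [f fK fE].
pose leT := relpre f leq.
have leT_total : total leT by move=> x y; apply: leq_total.
have leT_tr : transitive leT by move=> y x z; apply: leq_trans.
pose s := sort leT (enum G).
have ss x : x \in s by rewrite mem_sort mem_enum.
have lts x : index x s < #|G|.
  by rewrite cardE -(size_sort leT) index_mem.
pose sigma := [ffun x => Ordinal (lts x)].
have sinj : injective sigma.
  by move=> x y; rewrite !ffunE => -[] /index_inj; apply.
have smono x y : sigma x < sigma y -> f x <= f y.
  rewrite !ffunE /=.
  exact: (sorted_ltn_index leT_tr (sort_sorted leT_total _)).
apply/bigmax_leqP => k /altitude_geP/(_ sigma sinj)[c].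
case/and3P=> c2 /andP[cc _] /existsP[i].
set d := rot i c => sd; move: cc; rewrite -(rot_cycle i) -/d => cd.
rewrite -(size_rot i) -/d in c2 * => kd; apply: leq_trans kd _.
case: d sd c2 cd => // x d; rewrite /= rcons_path => sd d0 /andP[pd xd].
(* Colours never decrease along the ordering, so each ascending edge raises the colour by at least
   2. *)
have {sd pd} : f x + 2 * size d <= f (last x d).
  elim: d x sd pd {d0 xd} => [|y d IHd] x /=; first by rewrite addn0.
  case/andP=> xy sd /andP[/fE exy pd].
  have := IHd y sd pd; have := smono _ _ xy; move: exy; rewrite /circ_far; lia.
(* The closing edge goes around through 0 and costs 2 more, so twice the length is at most [K]. *)
have := fE _ _ xd; have := fK (last x d); rewrite /circ_far; move: d0; lia.
Qed.

(** * Cochains mod 2 on sequences *)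

Section Coboundary.

Variables S T : Type.
Implicit Types (F : seq T -> bool) (f g : S -> T).

Fixpoint cobd F (s : seq T) : bool :=
  if s is x :: s' then F s' (+) cobd (fun t => F (x :: t)) s' else false.

(** Dual of the prism operator: the sum of [F] over the staircases f x_0, ..., f x_i, g x_i, ..., g
    x_n. *)
Fixpoint prism f g F (s : seq S) : bool :=
  if s is x :: s'
  then F (f x :: g x :: map g s') (+) prism f g (fun t => F (f x :: t)) s'
  else false.

Lemma cobd_add F F' s :
  cobd (fun t => F t (+) F' t) s = cobd F s (+) cobd F' s.
Proof. by elim: s F F' => //= x s IHs F F'; rewrite IHs addbACA. Qed.

Lemma cobd_and b F s : cobd (fun t => b && F t) s = b && cobd F s.
Proof. by elim: s F => [|x s IHs] F; rewrite /= ?andbF // IHs andb_addr. Qed.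

Lemma prism_add f g F F' s :
  prism f g (fun t => F t (+) F' t) s = prism f g F s (+) prism f g F' s.
Proof. by elim: s F F' => //= x s IHs F F'; rewrite IHs addbACA. Qed.

End Coboundary.

(** Pulling back along a map of vertices commutes with the coboundary. *)
Lemma cobd_map (S T : Type) (f : S -> T) F s :
  cobd (fun t => F (map f t)) s = cobd F (map f s).
Proof. by elim: s F => //= x s IHs F; rewrite -IHs. Qed.

(** The chain homotopy formula between [f] and [g], without signs since it is mod 2. *)
Lemma prism_cobd (S T : Type) (f g : S -> T) F s :
  prism f g (cobd F) s =
  F (map f s) (+) F (map g s) (+) cobd (prism f g F) s.
Proof.
elim: s F => [|x s IHs] F /=; first by rewrite addbb.
rewrite prism_add IHs !cobd_add (cobd_map g (fun t => F (f x :: g x :: t))).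
move: (cobd _ (map g s)) (cobd _ s) (prism _ _ _ _) => a b c.
by do 3?case: (F _); case: a b c => -[] [].
Qed.

Lemma eq_cobd (T : eqType) (F F' : seq T -> bool) s :
  (forall t, subseq t s -> (size t).+1 = size s -> F t = F' t) ->
  cobd F s = cobd F' s.
Proof.
elim: s F F' => [//|x s IHs] F F' eqF /=; congr (_ (+) _).
  by apply: eqF => //; apply: subseq_cons.
by apply: IHs => t ts szt; apply: eqF; rewrite /= ?eqxx // szt.
Qed.

Lemma eq_prism (S : Type) (T : eqType) (f g : S -> T) (F F' : seq T -> bool) s :
  (forall t, {subset t <= map f s ++ map g s} -> size t = (size s).+1 ->
    F t = F' t) ->
  prism f g F s = prism f g F' s.
Proof.
elim: s F F' => //= x s IHs F F' eqF; congr (_ (+) _).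
  apply: eqF; rewrite /= ?size_map // => y.
  rewrite !(inE, mem_cat) => /or3P[->|->|->]; by rewrite ?orbT.
apply: IHs => t ts szt; apply: eqF; rewrite /= ?szt // => y.
rewrite !(inE, mem_cat) => /orP[->//|/ts].
by rewrite mem_cat => /orP[] ->; rewrite ?orbT.
Qed.

(* F is a cochain on unordered simplices, so its coboundary may be computed    *)
(* by deleting elements rather than positions.                                 *)
Lemma cobd_perm (T : eqType) (F : seq T -> bool) s :
  (forall t t', perm_eq t t' -> F t = F t') ->
  cobd F s = \big[addb/false]_(x <- s) F (rem x s).
Proof.
elim: s F => [|x s IHs] F permF; first by rewrite big_nil.
rewrite big_cons /= eqxx; congr (_ (+) _).
rewrite IHs => [|t t' tt']; last by apply: permF; rewrite perm_cons.
rewrite big_seq [RHS]big_seq; apply: eq_bigr => y ys.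
by case: eqP ys => // <- xs; apply: permF; rewrite perm_sym perm_to_rem.
Qed.

Lemma perm_cobd (T : eqType) (F : seq T -> bool) s s' :
  (forall t t', perm_eq t t' -> F t = F t') -> perm_eq s s' ->
  cobd F s = cobd F s'.
Proof.
move=> permF ss'; rewrite !cobd_perm // -(perm_big _ ss') /=.
apply: eq_big_seq => x xs; apply: permF; rewrite -(perm_cons x).
have xs' : x \in s' by rewrite -(perm_mem ss').
by rewrite -(permPl (perm_to_rem xs)) -(permPr (perm_to_rem xs')).
Qed.

Fixpoint alternating (b : bool) (s : seq bool) : bool :=
  if s is c :: s' then (c == b) && alternating (~~ b) s' else true.

(** An alternating word yields one starting with [b] by a single deletion: of its last letter if it
    starts with [b], of its first otherwise. In a word with one repetition the two equal neighbours
    give the same result, so these deletions cancel. *)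
Lemma cobd_alternating b s :
  cobd (alternating b) s = alternating b s (+) alternating (~~ b) s.
Proof.
elim: s b => //= c s IHs b; rewrite cobd_and IHs negbK.
by case: c b (alternating _ s) (alternating _ s) => -[] [] [].
Qed.

Lemma alternating_negb b s : alternating b (map negb s) = alternating (~~ b) s.
Proof. by elim: s b => //= c s IHs b; rewrite IHs; case: c b => -[]. Qed.

Lemma last_alternating b c s :
  alternating b (c :: s) -> last c s = b (+) odd (size s).
Proof.
elim: s b c => [|d s IHs] b c /=; first by rewrite andbT addbF => /eqP.
case/andP=> _ /IHs ->; by case: b; case: odd.
Qed.

(** * Fan's counting argument *)

Section Hemispheres.

Variable G : sgraph.
Local Notation signed := (bool * G)%type.

Definition antipode (p : signed) : signed := (~~ p.1, p.2).

(** No vertex occurs with both signs, as [edge] is irreflexive. Repeated entries are allowed: such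
    degenerate simplices do not alternate once sorted. *)
Definition signed_biclique (s : seq signed) : bool :=
  allrel (fun p q => (p.1 != q.1) ==> edge p.2 q.2) s s.

Lemma signed_bicliqueP (s : seq signed) :
  reflect {in s &, forall p q, p.1 != q.1 -> edge p.2 q.2} (signed_biclique s).
Proof.
apply: (iffP allrelP) => H p q ps qs; first by move/implyP: (H p q ps qs).
by apply/implyP; apply: H.
Qed.

Lemma sub_signed_biclique s t :
  {subset s <= t} -> signed_biclique t -> signed_biclique s.
Proof.
move=> st /signed_bicliqueP H; apply/signed_bicliqueP=> p q ps qs.
by apply: H; apply: st.
Qed.

Lemma signed_biclique_antipode s :
  signed_biclique s -> signed_biclique (map antipode s).
Proof.
move=> /signed_bicliqueP H; apply/signed_bicliqueP=> _ _ /mapP[p ps ->] /mapP[q qs ->] /=.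
by rewrite (inj_eq negb_inj); apply: H.
Qed.

Definition chain_linear (c : (seq signed -> bool) -> bool) : Prop :=
  forall F F', c (fun s => F s (+) F' s) = c F (+) c F'.

Definition chain_support (d : nat) (c : (seq signed -> bool) -> bool) : Prop :=
  forall F F', (forall s, signed_biclique s -> size s = d.+1 -> F s = F' s) ->
    c F = c F'.

(* A mod 2 chain c of dimension d in the complex of signed bicliques is given  *)
(* by its pairing with cochains. It is a d-dimensional hemisphere if its       *)
(* boundary is a (d-1)-dimensional hemisphere plus the antipode of the latter. *)
Fixpoint hemisphere (d : nat) (c : (seq signed -> bool) -> bool) : Prop :=
  [/\ chain_linear c, chain_support d c &
    if d is d'.+1 then
      exists2 c', hemisphere d' c' &
        forall F, c (cobd F) = c' F (+) c' (F \o map antipode)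
    else c predT].

Lemma hemisphere_linear d c : hemisphere d c -> chain_linear c.
Proof. by case: d => [|d] []. Qed.

Lemma hemisphere_support d c : hemisphere d c -> chain_support d c.
Proof. by case: d => [|d] []. Qed.

Lemma antipodeK : involutive antipode.
Proof. by case=> b x; rewrite /antipode /= negbK. Qed.

(** The boundary of [c] is invariant under the antipode, so [c] and its antipode have the same
    boundary: together they form a cycle, the whole sphere. *)
Lemma hemisphere_closed d c F : hemisphere d c ->
  c (cobd F) = c (cobd F \o map antipode).
Proof.
case: d => [|d] hc.
  by apply: (hemisphere_support hc) => -[|x [|]].
have [lin sup [c' hc' bd]] := hc; rewrite bd.
have -> : c (cobd F \o map antipode) = c (cobd (F \o map antipode)).
  by apply: sup => s _ _ /=; rewrite cobd_map.
rewrite bd addbC; congr (_ (+) _); apply: (hemisphere_support hc') => s _ _ /=.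
by rewrite (mapK antipodeK).
Qed.

Variables (pos : G -> nat).
Hypothesis pos_inj : injective pos.

Definition signed_pos (p : signed) : nat := (pos p.2).*2 + p.1.

Definition sort_signed := sort (relpre signed_pos leq).

Lemma signed_pos_inj : injective signed_pos.
Proof.
move=> [b x] [b' y]; rewrite /signed_pos /= => e.
have eb : b = b' by move/(congr1 odd): e; rewrite !oddD !odd_double !oddb.
by move: e; rewrite eb => /addIn/double_inj/pos_inj ->.
Qed.

Lemma signed_leq_total : total (relpre signed_pos leq).
Proof. by move=> p q; apply: leq_total. Qed.

Lemma signed_leq_trans : transitive (relpre signed_pos leq).
Proof. by move=> q p r; apply: leq_trans. Qed.

Lemma signed_leq_anti : antisymmetric (relpre signed_pos leq).
Proof. by move=> p q /anti_leq/signed_pos_inj. Qed.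

Definition alt (b : bool) (s : seq signed) : bool :=
  alternating b (map fst (sort_signed s)).

Lemma cobd_alt b s : cobd (alt b) s = alt b s (+) alt (~~ b) s.
Proof.
have perm_alt t t' : perm_eq t t' -> alt b t = alt b t'.
  by rewrite /alt => /(perm_sortP signed_leq_total signed_leq_trans signed_leq_anti); rewrite /sort_signed => ->.
have ss : perm_eq s (sort_signed s) by rewrite perm_sym perm_sort.
rewrite (perm_cobd perm_alt ss) /alt -cobd_alternating -cobd_map.
apply: eq_cobd => t ts _; rewrite /alt /sort_signed sorted_sort //.
  exact: signed_leq_trans.
by apply: subseq_sorted ts (sort_sorted signed_leq_total _); apply: signed_leq_trans.
Qed.

(** Opposite signs in a biclique sit on distinct vertices, so flipping all signs preserves the
    sorted order. *)
Lemma alt_antipode b s :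
  signed_biclique s -> alt b (map antipode s) = alt (~~ b) s.
Proof.
move=> /signed_bicliqueP bs; rewrite /alt -alternating_negb -!map_comp.
suff -> : sort_signed (map antipode s) = map antipode (sort_signed s).
  by rewrite -map_comp.
apply: (sorted_eq signed_leq_trans signed_leq_anti); first exact: sort_sorted signed_leq_total _.
  rewrite sorted_map.
  have : all [in s] (sort_signed s) by apply/allP=> p; rewrite mem_sort.
  move/sub_in_sorted; apply; last exact: sort_sorted signed_leq_total _.
  move=> [a x] [b' y] /bs /[apply] /=; rewrite /signed_pos /=.
  case: (eqVneq x y) => [->|nxy].
    by rewrite edge_irrefl; case: a b' => -[] // /(_ isT).
  have : pos x != pos y by apply: contra_neq nxy => /pos_inj.
  by case: a b' => -[] /=; lia.
by rewrite perm_sort perm_map // perm_sym perm_sort.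
Qed.

(** Alternating simplices are odd in number: by [cobd_alt] their count is a coboundary, and passing
    to the boundary turns it into the same count one dimension lower, down to an odd number of
    points. *)
Lemma hemisphere_alt d c : hemisphere d c ->
  c (fun s => alt true s (+) alt false s).
Proof.
elim: d c => [|d IHd] c [lin sup].
  by congr is_true; apply: sup => -[|[[] x] [|]].
case=> c' hc' bd.
rewrite (_ : c _ = c (cobd (alt true))); last by apply: sup => s _ _; rewrite cobd_alt.
rewrite bd; have := IHd _ hc'; rewrite (hemisphere_linear hc').
congr is_true; congr (_ (+) _); apply: (hemisphere_support hc') => s bs _.
by rewrite /= alt_antipode.
Qed.

Lemma hemisphere_zigzag d c : hemisphere d c ->
  exists2 s, signed_biclique s && (size s == d.+1) & exists b, alt b s.
Proof.
move=> hc; have [lin sup] := (hemisphere_linear hc, hemisphere_support hc).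
case: (boolP [exists s : d.+1.-tuple signed,
    signed_biclique s && (alt true s || alt false s)]) => [/existsP[s]|].
  case/andP=> bs altb; exists s; first by rewrite bs size_tuple eqxx.
  by case/orP: altb => ?; [exists true | exists false].
rewrite negb_exists => /forallP none.
have := hemisphere_alt hc.
(* Written as a sum so that linearity yields the value 0. *)
rewrite (sup _ (fun s => false (+) false)); first by rewrite lin addbb.
move=> s bs /eqP szs; have := none (Tuple szs); rewrite /= bs /=.
by case: (alt true s); case: (alt false s).
Qed.

Lemma zigzag_path b p s :
  signed_biclique (p :: s) -> alternating b (map fst (p :: s)) ->
  sorted (relpre signed_pos leq) (p :: s) ->
  path (fun p q => edge p.2 q.2 && (pos p.2 < pos q.2)) p s.
Proof.
elim: s b p => // q s IHs b p bs /= /andP[/eqP pb /andP[/eqP qb alts]].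
case/andP=> pq ss; apply/andP; split; last first.
  apply: (IHs (~~ b)) => //=; last by rewrite qb eqxx.
  by apply: sub_signed_biclique bs => x xs; rewrite inE xs orbT.
have epq : edge p.2 q.2.
  by move/signed_bicliqueP: bs; apply; rewrite ?inE ?eqxx ?orbT // pb qb; case: (b).
rewrite epq /= ltn_neqAle; apply/andP; split.
  by apply: contraTneq epq => /pos_inj ->; rewrite edge_irrefl.
by move: pq; rewrite /signed_pos pb qb; case: (b) => /=; lia.
Qed.

End Hemispheres.

Lemma hemisphere_altitude_ge (G : sgraph) (m : nat)
    (c : (seq (bool * G) -> bool) -> bool) :
  hemisphere (2 * m + 1) c -> altitude_ge G (2 * m + 2).
Proof.
move=> hc; apply/altitude_geP => sigma sinj.
pose pos x := val (sigma x).
have pos_inj : injective pos by move=> x y /val_inj/sinj.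
have [s /andP[bs /eqP szs] [b]] := hemisphere_zigzag pos_inj hc.
rewrite /alt; move: (sort_sorted (signed_leq_total pos) s).
rewrite -/(sort_signed pos s).
have {bs} : signed_biclique (sort_signed pos s).
  by apply: sub_signed_biclique bs => p; rewrite mem_sort.
have : size (sort_signed pos s) = 2 * m + 2 by rewrite size_sort szs addn1 addn2.
case: (sort_signed pos s) => {szs s} [|p s] szs bs ss alts; first by rewrite addnS in szs.
have zz := zigzag_path pos_inj bs alts ss.
have psort : sorted ltn (map (fun x => val (sigma x)) (map snd (p :: s))).
  rewrite -map_comp sorted_map /=; apply: sub_path zz => u v /andP[_].
  exact.
exists (map snd (p :: s)); last by rewrite size_map szs.
apply/and3P; split.
- by rewrite size_map szs addn2.
- apply/andP; split; last first.
    by have := sorted_uniq ltn_trans ltnn psort; move/map_uniq.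
  rewrite /= rcons_path path_map; apply/andP; split.
    by apply: sub_path zz => u v /andP[].
  have /signed_bicliqueP := bs; rewrite last_map; apply.
  + exact: mem_last.
  + exact: mem_head.
  rewrite -(last_map fst) /=; have /last_alternating -> := alts.
  (* With 2m + 2 vertices the first and last signs differ, so these two vertices are adjacent and
     the path closes up. *)
  have -> : odd (size (map fst s)).
    by move: szs; rewrite size_map /= addn2 => -[->]; rewrite /= oddM.
  by case/andP: alts => /eqP -> _; case: (b).
- apply/existsP; exists (Ordinal (isT : 0 < size (map snd (p :: s)))).
  by rewrite rot0.
Qed.

Lemma hemisphere_hom (G H : sgraph) (g : G -> H) (d : nat)
    (c : (seq (bool * G) -> bool) -> bool) :
  {homo g : x y / edge x y} -> hemisphere d c ->
  hemisphere d (fun F => c (F \o map (fun p => (p.1, g p.2)))).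
Proof.
move=> gE; set h := fun p : bool * G => _.
have lin d' c' : hemisphere d' c' -> chain_linear (fun F => c' (F \o map h)).
  by move=> /hemisphere_linear lin F F'; rewrite -lin.
have sup d' c' : hemisphere d' c' -> chain_support d' (fun F => c' (F \o map h)).
  move=> /hemisphere_support sup F F' eqF; apply: sup => s /signed_bicliqueP bs szs.
  apply: eqF; last by rewrite size_map.
  apply/signed_bicliqueP => p q /mapP[p' ps ->] /mapP[q' qs ->] /= pq.
  by apply/gE/bs.
elim: d c => [|d IHd] c hc; split; try exact: lin hc; try exact: sup hc.
  by case: hc.
have [_ supc [c' hc' bd]] := hc; exists (fun F => c' (F \o map h)); first exact: IHd.
move=> F; rewrite (supc _ (cobd (F \o map h))); last first.
  by move=> s _ _; rewrite /= cobd_map.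
rewrite bd; congr (_ (+) _); apply: (hemisphere_support hc') => s _ _ /=.
by rewrite -!map_comp.
Qed.

Lemma hemisphere_edge (G : sgraph) (x y : G) : edge x y ->
  exists c : (seq (bool * G) -> bool) -> bool, hemisphere 1 c.
Proof.
move=> xy; pose p b : bool * G := (b, x); pose q : bool * G := (false, y).
have bi : signed_biclique [:: p true; q].
  apply/signed_bicliqueP => u v; rewrite !inE.
  by case/orP=> /eqP -> /orP[] /eqP -> //= _; rewrite 1?edge_sym.
(* Half of a 4-cycle: the path from +x through -y to -x. *)
exists (fun F => F [:: p true; q] (+) F [:: q; p false]); split.
- by move=> F F'; rewrite addbACA.
- move=> F F' eqF; congr (_ (+) _); apply: eqF => //.
exists (fun F => F [:: p true]); first by split=> // F F' ->.
by move=> F /=; rewrite !addbF; case: (F _); case: (F _); case: (F _).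
Qed.

(** * The Mycielskian as a suspension *)

Section Suspension.

Variable G : sgraph.

Definition v_copy (p : bool * G) : bool * mycielskian G := (p.1, Some (inr p.2)).

(** Only positive vertices move to u-copies: u-copies are pairwise non-adjacent, so they must all
    have the same sign, opposite to that of the apex. *)
Definition u_copy (p : bool * G) : bool * mycielskian G :=
  (p.1, Some (if p.1 then inl p.2 else inr p.2)).

Definition negative_apex : bool * mycielskian G := (false, None).

Lemma signed_biclique_copies (s : seq (bool * G)) :
  signed_biclique s -> signed_biclique (map v_copy s ++ map u_copy s).
Proof.
move=> /signed_bicliqueP bs; apply/signed_bicliqueP => p q.
by rewrite !mem_cat => /orP[] /mapP[[a x] /bs bx ->] /orP[] /mapP[[b y] /bx + ->] /=;
  case: a bx => bx; case: b => // /(_ isT).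
Qed.

Lemma signed_biclique_cone (s : seq (bool * G)) :
  signed_biclique s -> signed_biclique (negative_apex :: map u_copy s).
Proof.
move=> bs; apply/signed_bicliqueP => p q.
have /signed_bicliqueP H : signed_biclique (map u_copy s).
  apply: sub_signed_biclique (signed_biclique_copies bs) => z zs.
  by rewrite mem_cat zs orbT.
rewrite !inE => /orP[/eqP-> | ps] /orP[/eqP-> | qs] //; last exact: H.
  by case/mapP: qs => -[[] y] _ ->.
by case/mapP: ps => -[[] y] _ ->.
Qed.

Definition suspension_cochain (F : seq (bool * mycielskian G) -> bool)
    (s : seq (bool * G)) : bool :=
  prism v_copy u_copy F s (+) F (negative_apex :: map u_copy s).

(** The far end of the prism cancels the base of the cone. *)
Lemma suspension_cochain_cobd F s :
  suspension_cochain (cobd F) s =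
  F (map v_copy s) (+) cobd (suspension_cochain F) s.
Proof.
rewrite /suspension_cochain prism_cobd cobd_add.
rewrite (cobd_map u_copy (fun t => F (negative_apex :: t))) /=.
move: (cobd _ _) (cobd _ _) => a b.
by do 2?case: (F _); case: a b => -[].
Qed.

Lemma mycielskian_hemisphere (d : nat) (c : (seq (bool * G) -> bool) -> bool) :
  hemisphere d c ->
  exists c' : (seq (bool * mycielskian G) -> bool) -> bool, hemisphere d.+1 c'.
Proof.
move=> hc; have [lin sup] := (hemisphere_linear hc, hemisphere_support hc).
(* The prism and cone are built over the whole sphere, [c] plus its antipode. By [hemisphere_closed]
   only the v-copy of that sphere is left as boundary. *)
exists (fun F => c (suspension_cochain F)
                 (+) c (suspension_cochain F \o map (@antipode G))); split.
- move=> F F'; rewrite addbACA.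
  by congr (_ (+) _); rewrite -lin; apply: sup => s _ _ /=;
    rewrite /suspension_cochain prism_add addbACA.
- move=> F F' eqF.
  have eqS s : signed_biclique s -> size s = d.+1 ->
      suspension_cochain F s = suspension_cochain F' s.
    move=> bs szs; rewrite /suspension_cochain; congr (_ (+) _).
      apply: eq_prism => t ts szt; apply: eqF; last by rewrite szt szs.
      exact: sub_signed_biclique ts (signed_biclique_copies bs).
    by apply: eqF; [apply: signed_biclique_cone | rewrite /= size_map szs].
  congr (_ (+) _); apply: sup => // s bs szs /=; apply: eqS.
    exact: signed_biclique_antipode.
  by rewrite size_map.
exists (fun F => c (F \o map v_copy)).
  by apply: (@hemisphere_hom G (mycielskian G) (fun x => Some (inr x))).
move=> F.
rewrite (sup _ (fun s => (F \o map v_copy) s (+) cobd (suspension_cochain F) s));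
  last by move=> s _ _; rewrite suspension_cochain_cobd.
rewrite (sup (_ \o map (@antipode G)) (fun s => (F \o map v_copy \o map (@antipode G)) s
    (+) (cobd (suspension_cochain F) \o map (@antipode G)) s));
  last by move=> s _ _; rewrite /= suspension_cochain_cobd.
rewrite !lin (hemisphere_closed _ hc) addbACA addbb addbF.
by congr (_ (+) _); apply: sup => s _ _ /=; rewrite -!map_comp.
Qed.

End Suspension.

Lemma iter_mycielskian_hemisphere (G : sgraph) (d e : nat)
    (c : (seq (bool * G) -> bool) -> bool) :
  hemisphere d c ->
  exists c' : (seq (bool * iter e mycielskian G) -> bool) -> bool,
    hemisphere (e + d) c'.
Proof.
move=> hc; elim: e => [|e [c' hc']]; first by exists c.
exact: mycielskian_hemisphere hc'.
Qed.

Theorem theorem1p2 (r n : nat) (hn : r + 1 < n) :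
  let G := iter (2 * r) mycielskian (cycle_graph (2 * n + 1)) in
  [/\ clique_number G = 2,
      circular_altitude G = 2 * r + 2 &
      chromatic_number G = 2 * r + 3].
Proof.
move=> G; have n1 : 1 < n by lia.
have lt0 : 0 < 2 * n + 1 by rewrite addn1.
have lt1 : 1 < 2 * n + 1 by lia.
have e01 := cycle_graph_edgeS lt0 lt1.
have [x [y xy]] : exists x y : G, edge x y.
  rewrite /G; elim: (2 * r) => [|d [x [y xy]]]; first by do 2!eexists; exact: e01.
  by exists (Some (inr x)), (Some (inr y)).
split.
- apply: triangle_free_clique_number xy; rewrite /G.
  elim: (2 * r) => [|d]; last exact: mycielskian_triangle_free.
  by apply: cycle_graph_triangle_free; lia.
- apply/eqP; rewrite eqn_leq; apply/andP; split.
    (* The bound is tight: 5 + 4r = 2(2r + 2) + 1. *)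
    apply: (@circular_altitude_circ_colorable (5 + 4 * r)); try lia.
    exact/circ_colorable_iter_mycielskian/circ_colorable_odd_cycle.
  have [|_] := @circular_altitude_largest G; first by exists x, y.
  have [c hc] := hemisphere_edge e01.
  have [c' hc'] := iter_mycielskian_hemisphere (2 * r) hc.
  by apply; apply: hemisphere_altitude_ge hc'.
- apply: chromatic_number_iter_mycielskian.
    exact: colorable_odd_cycle_graph.
  by apply: odd_cycle_graph_not_bipartite; lia.
Qed.
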